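(* Let $\beta\in(0,1]$, $R>0$, and $w\in L^2([0,1])$ with $\|w\|_{L^2}>0$. For estimating $\theta=\int_0^1g(x)w(x)\,dx$ over the parameter class $\mathcal C^\beta(R)$ the following asymptotic lower bound holds: $$\liminf_{n\to\infty}\ \inf_{\hat\theta_n}\ \sup_{g\in\mathcal C^\beta(R)}R^{-1/(\beta+1)}\,n^{(2\beta+1)/(\beta+1)}\,\|w\|_{L^2}^{-2}\;\mathbb E_g[(\hat\theta_n-\theta)^2]>0,$$ where the infimum extends over all estimators $\hat\theta_n$ (measurable functions of the observations) in the Poisson point process model with intensity $\lambda_g(x,y)=n\mathbf 1(y\ge g(x))$ on $[0,1]\times\mathbb R$.
   Context: $\mathcal C^{\beta}(R)=\{f:[0,1]\to\mathbb R \mid |f(y)-f(x)|\le R|y-x|^\beta\ \forall x,y\in[0,1]\}$. Observation model (PPP model): under $P_g$ (expectation $\mathbb E_g$) one observes the points $(X_j,Y_j)_{j\ge1}$ of a Poisson point process on $[0,1]\times\mathbb R$ with intensity $\lambda_g(x,y)=n\mathbf 1(y\ge g(x))$. *)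

(* Defs.v *)
From HB Require Import structures.
From mathcomp Require Import all_boot all_order all_algebra.
From mathcomp Require Import all_classical all_reals all_analysis measurable_realfun.

Set Implicit Arguments.
Unset Strict Implicit.
Unset Printing Implicit Defensive.

Import Order.TTheory GRing.Theory Num.Theory.
Import numFieldNormedType.Exports.

Local Open Scope classical_set_scope.
Local Open Scope ring_scope.

(* Functions on [0, 1] are represented by functions on the whole line; only
   their values on [0, 1] are ever used. *)
Definition holder_class (R : realType) (beta rad : R) : set (R -> R) :=
  [set f | forall x y : R, x \in `[0, 1] -> y \in `[0, 1] ->
    `|f y - f x| <= rad * `|y - x| `^ beta].

Section point_configurations.
Context d (T : measurableType d) (R : realType).

(* A realization of a simple point process: its unordered set of points. *)
Record configuration := Configuration {
  points :> set T;
  countable_points : countable points }.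

HB.instance Definition _ := gen_eqMixin configuration.
HB.instance Definition _ := gen_choiceMixin configuration.
HB.instance Definition _ :=
  isPointed.Build configuration (Configuration (@countable0 T)).

Definition npoints (A : set T) (S : configuration) : \bar R :=
  counting (points S `&` A).

Definition npoints_events : set (set configuration) :=
  [set npoints A @^-1` B | A in measurable & B in measurable].

(* Configurations with the sigma-algebra generated by the counts N(A), A
   measurable: the information carried by the observed points, without any
   labelling of them. *)
Definition configurations : measurableType npoints_events.-sigma :=
  g_sigma_algebraType npoints_events.

Local Open Scope ereal_scope.

(* P is the law of a Poisson point process with mean measure L.
   In poisson_prob the second argument is a dummy, and rate 0 gives the Dirac
   mass at 0. Since some of the B i may be setT, the product rule over a full
   family includes the one over each of its subfamilies. *)
Definition is_poisson_process (L : set T -> \bar R)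
    (P : probability configurations R) : Prop :=
  [/\ forall A, measurable A -> L A \is a fin_num ->
        forall k : nat,
          P [set S : configurations | npoints A S = k%:R%:E] =
          poisson_prob (fine (L A)) 0%N [set k],
      forall A, measurable A -> L A = +oo ->
        P [set S : configurations | npoints A S = +oo] = 1
    & forall (m : nat) (A : 'I_m -> set T) (B : 'I_m -> set (\bar R)),
        (forall i, measurable (A i)) -> (forall i, measurable (B i)) ->
        trivIset setT A ->
        P [set S : configurations | forall i, B i (npoints (A i) S)] =
        \prod_(i < m) P [set S : configurations | B i (npoints (A i) S)]].

End point_configurations.

Section boundary_model.
Context (R : realType).

Definition plane : measurableType _ :=
  (measurableTypeR R * measurableTypeR R)%type.

Definition boundary_intensity (n : nat) (g : R -> R) (z : plane) : R :=
  if g z.1 <= z.2 then n%:R else 0.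

Definition strip : set plane := [set z | z.1 \in `[0, 1]].

Definition boundary_mean_measure (n : nat) (g : R -> R) (A : set plane)
    : \bar R :=
  (\int[lebesgue_measure \x lebesgue_measure]_(z in strip `&` A)
    (boundary_intensity n g z)%:E)%E.

Definition on_unit_interval (w : R -> R) : measurableTypeR R -> R :=
  w \_ `[0, 1].

Definition L2norm (w : R -> R) : R :=
  fine 'N[lebesgue_measure]_2%:E[EFin \o on_unit_interval w]%E.

Definition weighted_integral (w g : R -> R) : R :=
  (\int[lebesgue_measure]_(x in `[0, 1]) (g x * w x)).

End boundary_model.

Notation observation R := (configurations (plane R) R).

Definition estimator (R : realType) : set (observation R -> R) :=
  [set theta_hat | measurable_fun setT theta_hat].

Definition squared_risk (R : realType) (P : probability (observation R) R)
    (theta_hat : observation R -> R) (theta : R) : \bar R :=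
  'E_P[fun S => ((theta_hat S - theta) ^+ 2)%R]%E.

(* Main.v *)
(* Take as alternatives the functions g_e, e a set of indices, equal to the
   maximum over e of disjoint hats of width and height h and rad h^beta, with
   h of order n^(-1/(beta+1)). The Poisson process with boundary g_e is the one
   with boundary 0 conditioned on having no point in the subgraph D_e of g_e,
   an event of probability exp (- L (D_e)). With prior weights proportional to
   these probabilities, the posterior given the observed points is therefore
   uniform over the sets e of hats containing no point. The posterior variance of
   theta = sum_(i in e) a_i is a quarter of the sum of the a_i^2 over the
   hats i containing no point, and each hat contains none with a probability
   bounded below, since n h^(beta+1) is bounded. Finally, the hats centred at
   all (k + 1) h, k < 2m, sum up to a trapezoid approximating the indicator of
   an interval ]0, x0[ on which w has a nonzero integral; the hats of one parity
   carry at least half of that integral, and Cauchy-Schwarz bounds the sum of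
   their a_i^2 from below by a multiple of (rad h^beta)^2 h. *)
Require Import Defs.
From HB Require Import structures.
From mathcomp Require Import all_boot all_order all_algebra.
From mathcomp Require Import all_classical all_reals all_analysis measurable_realfun.
From mathcomp Require Import finmap ring lra zify.

Import Order.TTheory GRing.Theory Num.Theory.
Import numFieldNormedType.Exports.

Set Implicit Arguments.
Unset Strict Implicit.
Unset Printing Implicit Defensive.

Local Open Scope classical_set_scope.
Local Open Scope ring_scope.

(** * Configurations and void events *)

(** Lists of distinct points treat finite and infinite counts alike. *)
Lemma counting_geP (T : choiceType) (R : realType) (X : set T) (k : nat) :
  (k%:R%:E <= counting X :> \bar R)%E <->
  exists s : seq T, [/\ uniq s, size s = k & [set` s] `<=` X].
Proof.
split=> [kX|[s [us <- sX]]].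
  have [B BX kB] : exists2 B : {fset T}, [set` B] `<=` X & (k <= #|` B|)%N.
    have [fX|iX] := pselect (finite_set X); last exact: infinite_set_fset.
    exists (fset_set X); first by rewrite fset_setK.
    by move: kX; rewrite /counting asboolT// lee_fin ler_nat.
  exists (take k B); split; first by rewrite take_uniq.
    by rewrite size_takel.
  by move=> x /= /mem_take xB; exact: BX.
rewrite /counting; case: ifPn => [/asboolP fX|_]; last by rewrite leey.
rewrite lee_fin ler_nat; apply: uniq_leq_size => // x xs.
by rewrite in_fset_set//; apply/mem_set/sX.
Qed.

Lemma floor_eq_dist (R : realType) (u v : R) :
  Num.floor u = Num.floor v -> `|u - v| < 1.
Proof.
move=> uv.
have := floor_le u; have := floor_le v.
have := floorD1_gt u; have := floorD1_gt v.
rewrite uv intrD; set c := (Num.floor v)%:~R => ? ? ? ?.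
by rewrite ltr_norml; apply/andP; split; lra.
Qed.

Section void_events.
Context {R : realType}.
Implicit Types (A : set (plane R)) (S : observation R).

Definition void A : set (observation R) :=
  [set S | points S `&` A = set0].

Definition void_events : set (set (observation R)) :=
  [set void A | A in measurable].

(** Grid of half-open squares of side 1/(N+1), labelled by pairs of integers; the labels are
    countable, so unions over them stay measurable. *)
Definition cell_index (N : nat) (z : plane R) : int * int :=
  (Num.floor (N.+1%:R * z.1), Num.floor (N.+1%:R * z.2)).

Definition cell (N : nat) (p : int * int) : set (plane R) :=
  cell_index N @^-1` [set p].

Lemma measurable_cell N p : measurable (cell N p).
Proof.
have N0 : 0 < N.+1%:R :> R by [].
pose I (i : int) : set (measurableTypeR R) :=
  `[i%:~R / N.+1%:R, (i + 1)%:~R / N.+1%:R[%classic.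
rewrite (_ : cell N p = I p.1 `*` I p.2).
  by apply: measurableX; exact: measurable_itv.
have IE i x : (Num.floor (N.+1%:R * x) = i) <-> I i x.
  rewrite /I /= in_itv/= ler_pdivrMr// ltr_pdivlMr// mulrC.
  by split=> [/eqP|]; rewrite -floor_eq => // /eqP.
apply/seteqP; split=> [[x y] /= <-|[x y] [/= /IE Ix /IE Iy]].
  by split; apply/IE.
by rewrite /cell /cell_index /= Ix Iy; case: p {Ix Iy}.
Qed.

(** Points at distance d in one coordinate are separated once (N+1) d > 1, since equal floors force
    a distance below 1. The grids are not nested, so the claim covers all large N: finitely many
    pairs then share a common N. *)
Lemma cell_index_neq (y z : plane R) : y <> z ->
  exists N0, forall N, (N0 <= N)%N -> cell_index N y <> cell_index N z.
Proof.
have sep (a b : R) : a != b -> exists N0, forall N, (N0 <= N)%N ->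
    Num.floor (N.+1%:R * a) <> Num.floor (N.+1%:R * b).
  move=> ab; have d0 : 0 < `|a - b| by rewrite normr_gt0 subr_eq0.
  exists (Num.truncn (`|a - b|^-1)) => N N0N fab.
  have : 1 < N.+1%:R * `|a - b|.
    rewrite -ltr_pdivrMr// div1r (lt_le_trans (truncnS_gt _))//.
    by rewrite ler_nat.
  rewrite -[X in X * `|_|](ger0_norm (_ : 0 <= N.+1%:R))// -normrM mulrBr.
  by apply/negP; rewrite -leNgt ltW// floor_eq_dist.
case: y => y1 y2; case: z => z1 z2 /= yz.
have [e1|/sep[N0 N0P]] := eqVneq y1 z1; last first.
  by exists N0 => N /N0P h [].
have [e2|/sep[N0 N0P]] := eqVneq y2 z2; last first.
  by exists N0 => N /N0P h [].
by exfalso; apply: yz; rewrite e1 e2.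
Qed.

Lemma uniq_cell_index (s : seq (plane R)) : uniq s ->
  exists N0, forall N, (N0 <= N)%N -> uniq (map (cell_index N) s).
Proof.
have notin z (r : seq (plane R)) : z \notin r ->
    exists N0, forall N, (N0 <= N)%N ->
      cell_index N z \notin map (cell_index N) r.
  elim: r => [|y r IH]; first by exists 0%N.
  rewrite inE negb_or => /andP[/eqP/cell_index_neq[N1 h1] /IH[N2 h2]].
  exists (maxn N1 N2) => N; rewrite geq_max => /andP[/h1/eqP N1N /h2 N2N].
  by rewrite inE negb_or N1N.
elim: s => [|z s IH] /=; first by exists 0%N.
move=> /andP[/notin[N1 h1] /IH[N2 h2]].
exists (maxn N1 N2) => N; rewrite geq_max => /andP[/h1 -> /h2 ->].
by [].
Qed.

(* Configurations are sets, without multiplicities, so that on a fine enough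
   grid counts are determined by the empty cells. *)
Lemma npoints_ge_cells A (k : nat) :
  [set S : observation R | (k%:R%:E <= npoints R A S)%E] =
  \bigcup_(p in [set p : nat * seq (int * int) | uniq p.2 && (size p.2 == k)])
    \big[setI/setT]_(i <- p.2) ~` void (A `&` cell p.1 i).
Proof.
apply/seteqP; split=> [S /= /counting_geP[s [us sk sSA]]|].
  have [N0 /(_ _ (leqnn _)) uN] := uniq_cell_index us.
  exists (N0, map (cell_index N0) s); first by rewrite /= uN size_map sk eqxx.
  rewrite -bigcap_seq => i /= /mapP[z zs ->] v0.
  have [Sz Az] := sSA z zs.
  by have : set0 z by rewrite -v0.
move=> S [[N r] /= /andP[ur /eqP rk]]; rewrite -bigcap_seq => Sr.
apply/counting_geP.
(* One point of A in each listed cell; [(0, 0)] is a dummy for labels outside [r], so that [choice]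
   applies. *)
have pt i : exists z, i \in r -> [/\ points S z, A z & cell_index N z = i].
  have [ir|_] := boolP (i \in r); last by exists (0, 0).
  have [z [Sz [Az iz]]] : points S `&` (A `&` cell N i) !=set0.
    by apply/set0P/eqP; apply: Sr.
  by exists z.
have [f fP] := choice pt.
exists (map f r); split; last 2 first.
- by rewrite size_map.
- by move=> _ /mapP[i ir ->]; have [] := fP i ir.
rewrite map_inj_in_uniq// => i j ir jr fij.
by have [_ _ <-] := fP i ir; have [_ _ <-] := fP j jr; rewrite fij.
Qed.

(** A count equals k when it is at least k but not at least k+1, and is infinite when it is at least
    every k. The last factor is everything or empty: without it, the intersection over no index
    would be the whole space when [+oo] is not in B. *)
Lemma npoints_preimage A (B : set (\bar R)) :
  npoints R A @^-1` B =
  (\bigcup_(k in [set k : nat | B k%:R%:E])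
     ([set S : observation R | (k%:R%:E <= npoints R A S)%E] `\`
      [set S : observation R | (k.+1%:R%:E <= npoints R A S)%E])) `|`
  (\bigcap_(k in [set k : nat | B +oo%E])
     [set S : observation R | (k%:R%:E <= npoints R A S)%E]) `&`
     [set S : observation R | B +oo%E].
Proof.
apply/seteqP; split=> S /=.
  rewrite /npoints /counting; case: ifPn => fS BS.
    left; exists #|` fset_set (points S `&` A)|; first exact: BS.
    rewrite /npoints /counting /= fS; split => //.
    by rewrite lee_fin ler_nat ltnn.
  by right; split=> // k _ /=; rewrite /npoints /counting (negbTE fS) leey.
case=> [[k /= Bk []]|[]].
  rewrite /npoints /counting; case: ifPn => fS; last by rewrite !leey.
  rewrite !lee_fin !ler_nat => k1 /negP; rewrite -ltnNge ltnS => k2.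
  by have <- : k = #|` fset_set (points S `&` A)| by apply/eqP; rewrite eqn_leq k1.
move=> Sk Boo; suff -> : npoints R A S = +oo%E by [].
move: Sk; rewrite /npoints /counting; case: ifPn => // fS.
move=> /(_ #|` fset_set (points S `&` A)|.+1 Boo) /=.
by rewrite /npoints /counting fS lee_fin ler_nat ltnn.
Qed.

End void_events.

Lemma void_npoints (R : realType) (A : set (plane R)) :
  void A = [set S | npoints R A S = 0%E].
Proof.
apply/seteqP; split=> S; rewrite /void /npoints /=.
  by move=> ->; rewrite /counting asboolT// fset_set0.
move=> N0; apply/seteqP; split=> // z SAz.
have : (1%:R%:E <= npoints R A S)%E.
  by apply/counting_geP; exists [:: z]; split=> // y; rewrite /= inE => /eqP->.
by rewrite /npoints N0 lee_fin ler10.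
Qed.

(** By [npoints_ge_cells], events bounding a count from below are countable unions of finite
    intersections of complements of void events; [npoints_preimage] reaches all count events from
    them. *)
Lemma sigma_void_events (R : realType) :
  (@measurable _ (observation R)) = <<s @void_events R >>.
Proof.
pose V := g_sigma_algebraType (@void_events R).
have voidV (A : set (plane R)) : measurable A -> @measurable _ V (void A).
  by move=> mA; apply: sub_sigma_algebra; exists A.
have geV (A : set (plane R)) k : measurable A ->
    @measurable _ V [set S : observation R | (k%:R%:E <= npoints R A S)%E].
  move=> mA; rewrite npoints_ge_cells.
  rewrite bigcup_mkcond.
  apply: (@countable_bigcupT_measurable _ V) => [|p]; first exact: countableP.
  case: ifPn => _; last exact: (@measurable0 _ V).
  apply: (@bigsetI_measurable _ V) => i _; apply: (@measurableC _ V).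
  by apply: voidV; apply: measurableI => //; exact: measurable_cell.
apply/seteqP; split; last first.
  apply: smallest_sub; first exact: sigma_algebra_measurable.
  move=> _ [A mA <-]; apply: sub_sigma_algebra; exists A => //.
  exists [set 0%E]; first exact: emeasurable_set1.
  by rewrite void_npoints.
apply: smallest_sub; first exact: smallest_sigma_algebra.
move=> _ [A mA [B mB <-]]; rewrite npoints_preimage.
apply: (@measurableU _ V).
  apply: (@bigcup_measurable _ V) => k _.
  by apply: (@measurableD _ V); exact: geV.
have [BT|BT] := pselect (B +oo%E); last first.
  rewrite [X in _ `&` X](_ : _ = set0) ?setI0; first exact: (@measurable0 _ V).
  by apply/seteqP; split.
rewrite [X in _ `&` X](_ : _ = setT) ?setIT; last by apply/seteqP; split.
by apply: (@bigcap_measurable _ V) => [|k _]; [exists 0%N|exact: geV].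
Qed.

Lemma voidU (R : realType) (A B : set (plane R)) :
  void (A `|` B) = void A `&` void B.
Proof. by rewrite /void; apply/seteqP; split=> S; rewrite /= setIUr setU_eq0. Qed.

Lemma setI_closed_void (R : realType) : setI_closed (@void_events R).
Proof.
move=> _ _ [A mA <-] [B mB <-]; exists (A `|` B); first exact: measurableU.
exact: voidU.
Qed.

Lemma measurable_void (R : realType) (A : set (plane R)) :
  measurable A -> measurable (void A).
Proof.
by move=> mA; rewrite sigma_void_events; apply: sub_sigma_algebra; exists A.
Qed.

(** * Void probabilities and conditioning of Poisson processes *)

Section poisson_void.
Local Open Scope ereal_scope.
Context (R : realType).
Implicit Types (L : set (plane R) -> \bar R) (P : probability (observation R) R).

Lemma poisson_void L P (A : set (plane R)) : is_poisson_process L P ->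
  measurable A -> 0 <= L A -> P (void A) = expeR (- L A).
Proof.
move=> [Pfin Pinf _] mA LA0.
have [LAfin|] := boolP (L A \is a fin_num); last first.
  rewrite ge0_fin_numE// -leNgt leye_eq => /eqP LAoo; rewrite LAoo /=.
  have mv := measurable_void mA.
  apply/eqP; rewrite eq_le measure_ge0 andbT.
  (* An almost surely infinite count leaves no mass to the void event, in agreement with exp(-oo) =
     0. *)
  have : P (~` void A) = 1.
    apply/eqP; rewrite eq_le probability_le1 ?andTb; last exact: measurableC.
    rewrite -(Pinf A mA LAoo); apply: le_measure.
    - apply/mem_set; apply: sub_sigma_algebra; exists A => //.
      by exists [set +oo]; first exact: emeasurable_set1.
    - exact/mem_set/measurableC.
    - by move=> S /= NS; rewrite void_npoints /= NS.
  have Pvfin : P (void A) \is a fin_num by exact: fin_num_measure.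
  rewrite probability_setC// -(fineK Pvfin) => -[].
  by move=> e; rewrite lee_fin; lra.
have -> : void A = [set S : observation R | npoints R A S = 0%:R%:E].
  exact: void_npoints.
rewrite Pfin// /poisson_prob; move: LA0; rewrite -(fineK LAfin) lee_fin /=.
case: ltP => [l0 _|l0 l1]; last first.
  rewrite diracE mem_set// (_ : fine (L A) = 0%R) ?oppr0 ?expR0//.
  by apply/eqP; rewrite eq_le l0.
rewrite esum_set1 ?lee_fin ?poisson_pmf_ge0// /poisson_pmf l0.
by rewrite expr0 fact0 invr1 !mul1r.
Qed.

(* Renyi's principle: void events are a generating pi-system, so that it is
   enough to compare void probabilities. *)
Lemma poisson_conditioning L L' P P' (D : set (plane R)) :
  is_poisson_process L P -> is_poisson_process L' P' ->
  (forall A, measurable A -> 0 <= L A) ->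
  (forall A, measurable A -> L (A `|` D) = L D + L (A `\` D)) ->
  (forall A, measurable A -> L' A = L (A `\` D)) ->
  measurable D -> L D < +oo ->
  forall E, measurable E -> P (E `&` void D) = expeR (- L D) * P' E.
Proof.
move=> PL PL' L0 LD L'E mD LDoo.
have LDfin : L D \is a fin_num by rewrite ge0_fin_numE ?L0.
have c0 : (0 <= expR (- fine (L D)))%R by exact: expR_ge0.
have mvD := measurable_void mD.
have -> : expeR (- L D) = (expR (- fine (L D)))%:E by rewrite -(fineK LDfin).
move=> E mE.
suff : mrestr P mvD E = mscale (NngNum c0) P' E by [].
(* Both sides are finite measures in E. Since [void set0] is the whole space, a constant sequence
   exhausts it. *)
apply: (measure_unique (@void_events R) (fun=> void set0)) => //.
- exact: sigma_void_events.
- exact: setI_closed_void.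
- by move=> _; exists set0 => //; exact: measurable0.
- apply/seteqP; split=> // S _; exists 0%N => //.
  by rewrite /void /= setI0.
(* On [void A] both sides are exp(-L(D)) exp(-L(A \ D)), the second factor being P'(void A). *)
- move=> _ [A mA <-]; rewrite [LHS](_ : _ = P (void (A `|` D))); last by rewrite voidU.
  rewrite [RHS](_ : _ = (expR (- fine (L D)))%:E * P' (void A))//.
  have mAD := measurableD mA mD; have mAUD := measurableU _ _ mA mD.
  rewrite (poisson_void PL)// ?L0// LD//.
  rewrite oppeD ?fin_num_adde_defr// expeRD.
  by rewrite (poisson_void PL')// L'E ?L0//; congr (_ * _); rewrite -{1}(fineK LDfin).
- move=> _; apply: (le_lt_trans (probability_le1 _ _)).
    by apply: measurableI => //; exact: measurable_void.
  by rewrite ltry.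
Qed.

Lemma poisson_conditioning_integral L L' P P' (D : set (plane R))
    (f : observation R -> \bar R) :
  is_poisson_process L P -> is_poisson_process L' P' ->
  (forall A, measurable A -> 0 <= L A) ->
  (forall A, measurable A -> L (A `|` D) = L D + L (A `\` D)) ->
  (forall A, measurable A -> L' A = L (A `\` D)) ->
  measurable D -> L D < +oo ->
  measurable_fun setT f -> (forall S, 0 <= f S) ->
  \int[P]_(S in void D) f S = expeR (- L D) * \int[P']_S f S.
Proof.
move=> PL PL' L0 LD L'E mD LDoo mf f0.
have LDfin : L D \is a fin_num by rewrite ge0_fin_numE ?L0.
have c0 : (0 <= expR (- fine (L D)))%R by exact: expR_ge0.
have mvD := measurable_void mD.
have PE := poisson_conditioning PL PL' L0 LD L'E mD LDoo.
rewrite (eq_measure_integral (mscale (NngNum c0) P')); last first.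
  move=> E mE ED; have EE : E `&` void D = E by exact/setIidPl.
  by have := PE _ mE; rewrite EE -{1}(fineK LDfin) => h; exact: h.
rewrite ge0_integral_mscale//; last exact: measurable_funTS.
rewrite -{2}(fineK LDfin) /=; congr (_ * _).
(* P' gives no mass to configurations meeting D: for E the complement of [void D], the left side of
   the conditioning identity is 0. *)
rewrite [RHS](@ge0_negligible_integral _ _ _ _ _ (~` void D))//.
  by rewrite setDE setCK setTI.
- exact: measurableC.
  have := PE _ (measurableC mvD); rewrite setICl measure0 -(fineK LDfin) /=.
  by move=> /esym/eqP; rewrite mule_eq0 eqe gt_eqF ?expR_gt0// => /eqP.
Qed.
End poisson_void.

(** * Boundary model *)

Section boundary_mean.
Local Open Scope ereal_scope.
Context (R : realType).
Implicit Types (g : R -> R) (n : nat) (A D : set (plane R)).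

(** The region that loses its intensity when the boundary is raised from 0 to a nonnegative g;
    heights below 0 carry none to begin with. *)
Definition subgraph g : set (plane R) :=
  [set z | z.1 \in `[0%R, 1%R] /\ (0 <= z.2 < g z.1)%R].

Lemma measurable_strip : measurable (@strip R).
Proof.
rewrite (_ : @strip R = `[0%R, 1%R]%classic `*` setT).
  by apply: measurableX => //; exact: measurable_itv.
by apply/seteqP; split=> z /=; [split|case].
Qed.

Lemma measurable_subgraph g :
  measurable_fun setT (g : measurableTypeR R -> measurableTypeR R) ->
  measurable (subgraph g).
Proof.
move=> mg.
rewrite (_ : subgraph g = @strip R `&`
    ((fun z : plane R => (0 <= z.2)%R) @^-1` [set true] `&`
    (fun z : plane R => (z.2 < g z.1)%R) @^-1` [set true])); last first.
  apply/seteqP; split=> z /=; rewrite /subgraph /strip /=.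
    by case=> -> /andP[-> ->].
  by case=> -> [-> ->].
apply: measurableI; first exact: measurable_strip.
apply: measurableI; rewrite -[X in measurable X]setTI.
  apply: measurable_fun_ler => //.
apply: measurable_fun_ltr => //.
exact: measurableT_comp.
Qed.

Lemma measurable_boundary_intensity0 n D :
  measurable_fun D (fun z : plane R => (boundary_intensity n (cst 0%R) z)%:E).
Proof.
apply: measurable_funTS; apply/measurable_EFinP; apply: measurable_fun_ifT => //.
exact: measurable_fun_ler.
Qed.

Lemma boundary_intensity_ge0 n g z : (0 <= boundary_intensity n g z)%R.
Proof. by rewrite /boundary_intensity; case: ifP. Qed.

Lemma boundary_mean_measure_ge0 n g A : 0 <= boundary_mean_measure n g A.
Proof.
by apply: integral_ge0 => z _; rewrite lee_fin boundary_intensity_ge0.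
Qed.

(** On the strip, a point is above g >= 0 exactly when it is above 0 and outside the subgraph. *)
Lemma boundary_mean_measureD n g A : {in `[0%R, 1%R], forall x, (0 <= g x)%R} ->
  boundary_mean_measure n g A =
  boundary_mean_measure n (cst 0%R) (A `\` subgraph g).
Proof.
move=> g0; rewrite /boundary_mean_measure integral_mkcond [RHS]integral_mkcond.
apply: eq_integral => z _; rewrite !patchE /boundary_intensity.
have [zA|zA] := boolP (z \in @strip R `&` A); last first.
  rewrite memNset// => -[zs [Az _]]; move/negP: zA; apply; exact/mem_set.
move/set_mem: zA => [zs Az].
have [gz|gz] := leP (g z.1) z.2.
  rewrite mem_set; last first.
    by split=> //; split=> // -[_ /andP[_]]; rewrite ltNge gz.
  by rewrite /= (le_trans _ gz)// g0.
case: ifPn => // /set_mem[_ [_ ng]]; case: ifPn => //= z0.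
by exfalso; apply: ng; split => //; rewrite z0.
Qed.

Lemma boundary_mean_measureU n A D : measurable A -> measurable D ->
  boundary_mean_measure n (cst 0%R) (A `|` D) =
  boundary_mean_measure n (cst 0%R) D +
  boundary_mean_measure n (cst 0%R) (A `\` D).
Proof.
move=> mA mD; have ms := measurable_strip; have mAD := measurableD mA mD.
rewrite /boundary_mean_measure.
rewrite (_ : @strip R `&` (A `|` D) = @strip R `&` D `|` (@strip R `&` (A `\` D))).
  rewrite ge0_integral_setU//.
  - exact: measurableI.
  - exact: measurableI.
  - exact: measurable_boundary_intensity0.
  - by move=> z _; rewrite lee_fin boundary_intensity_ge0.
  - by apply/disj_setPS => z [[_ Dz] [_ [_ /(_ Dz)]]].
by rewrite -setIUr [D `|` _]setUC setUDl setDv setD0.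
Qed.

Lemma le_boundary_mean_measure n A D : measurable A -> measurable D ->
  A `<=` D ->
  boundary_mean_measure n (cst 0%R) A <= boundary_mean_measure n (cst 0%R) D.
Proof.
move=> mA mD AD; have ms := measurable_strip.
apply: ge0_subset_integral; [exact: measurableI|exact: measurableI| | |exact: setIS].
- exact: measurable_boundary_intensity0.
- by move=> z _; rewrite lee_fin boundary_intensity_ge0.
Qed.

(** The intensity is at most n, so n times the area of an enclosing box bounds the mean number of
    points; used for the subgraph of a single hat. *)
Lemma boundary_mean_measure_box n D (a b c : R) : measurable D ->
  (0 <= b)%R -> (0 <= c)%R ->
  (forall z, D z -> (a <= z.1 <= a + b)%R && (0 <= z.2 <= c)%R) ->
  boundary_mean_measure n (cst 0%R) D <= (n%:R * (b * c))%:E.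
Proof.
move=> mD b0 c0 Dbox.
pose B : set (plane R) := `[a, (a + b)%R]%classic `*` `[0%R, c]%classic.
have mB : measurable B by apply: measurableX; exact: measurable_itv.
have ms := measurable_strip.
apply: (@le_trans _ _
  (\int[lebesgue_measure \x lebesgue_measure]_(z in B) (n%:R)%:E)).
  apply: (@le_trans _ _ (\int[lebesgue_measure \x lebesgue_measure]_(z in
      @strip R `&` D) (n%:R)%:E)).
    apply: ge0_le_integral => //.
    - exact: measurableI.
    - by move=> z _; rewrite lee_fin boundary_intensity_ge0.
    - exact: measurable_boundary_intensity0.
    - by move=> z _; rewrite lee_fin /boundary_intensity; case: ifP.
  apply: ge0_subset_integral => //; first exact: measurableI.
  by move=> z [_ /Dbox/andP[z1 z2]]; split; rewrite /= in_itv.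
rewrite integral_cst//=.
have -> : product_measure1 lebesgue_measure lebesgue_measure B = (b * c)%:E.
  have len (x y : R) : (x <= y)%R ->
      lebesgue_measure `[x, y]%classic = (y - x)%:E.
    rewrite lebesgue_measure_itv/= lte_fin le_eqVlt => /predU1P[->|->//].
    by rewrite ltxx subrr.
  rewrite /B product_measure1E; [|exact: measurable_itv..].
  rewrite [X in X * _]len ?lerDl// [X in _ * X]len// -EFinM.
  by rewrite subr0 addrAC subrr add0r.
by rewrite -EFinM.
Qed.

End boundary_mean.

(** * Lower bound on a hypercube of alternatives *)

(** Each subset avoiding k is paired with the one obtained by adding k. *)
Lemma big_subset_split (V : nmodType) (I : finType) (A : {set I}) (k : I)
    (F : {set I} -> V) : k \in A ->
  \sum_(e : {set I} | e \subset A) F e =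
  \sum_(e : {set I} | e \subset A :\ k) (F e + F (k |: e)).
Proof.
move=> kA; rewrite (bigID (fun e : {set I} => k \in e)) /= addrC big_split /=.
congr (_ + _).
  by apply: eq_bigl => e; rewrite finset.subsetD1.
rewrite (reindex_onto (fun e : {set I} => k |: e) (fun e => e :\ k)) /=.
  apply: eq_bigl => e; rewrite finset.setU11 andbT finset.subUset finset.sub1set kA /=.
  rewrite finset.subsetD1.
  have [ke|ke] := boolP (k \in e); last by rewrite finset.setU1K// eqxx.
  rewrite andbF; apply/negbTE; rewrite negb_and; apply/orP; right.
  by apply: contraL ke => /eqP <-; rewrite !inE eqxx.
by move=> e /andP[_ ke]; rewrite finset.setD1K.
Qed.

(* The left-hand side is 2 ^+ #|A| times the variance of the sum of the a i over
   a uniformly distributed subset of A. *)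
Lemma sum_sqr_dist_subset (R : realFieldType) (I : finType) (a : I -> R)
    (A : {set I}) (t : R) :
  2 ^+ #|A| / 4 * \sum_(i in A) a i ^+ 2 <=
  \sum_(e : {set I} | e \subset A) (t - \sum_(i in e) a i) ^+ 2.
Proof.
move cA : #|A| => m; elim: m => [|m IH] in A cA t *.
  have -> : A = finset.set0 by exact: cards0_eq.
  by rewrite big_set0 mulr0 sumr_ge0// => e _; exact: sqr_ge0.
have /card_gt0P[k kA] : (0 < #|A|)%N by rewrite cA.
have cAk : #|A :\ k| = m by move: cA; rewrite (cardsD1 k) kA add1n => -[].
rewrite (big_subset_split _ kA) (big_setD1 k)//=.
(* With s the distance for e, s^2 + (s - a_k)^2 = 2 (s - a_k/2)^2 + a_k^2/2. The induction
   hypothesis is then used at t - a_k/2, whence its generality in t. *)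
have -> : \sum_(e : {set I} | e \subset A :\ k)
    ((t - \sum_(i in e) a i) ^+ 2 + (t - \sum_(i in k |: e) a i) ^+ 2) =
  \sum_(e : {set I} | e \subset A :\ k)
    (2 * (t - a k / 2 - \sum_(i in e) a i) ^+ 2 + a k ^+ 2 / 2).
  apply: eq_bigr => e; rewrite finset.subsetD1 => /andP[_ ke].
  by rewrite big_setU1//=; field.
rewrite big_split/= -mulr_sumr sumr_const -cardsE.
rewrite (_ : finset _ = powerset (A :\ k)); last first.
  by apply/setP => e; rewrite !inE.
rewrite card_powerset cAk -[_ *+ (2 ^ m)%N]mulr_natr natrX.
have := IH _ cAk (t - a k / 2); rewrite exprS.
set s := \sum_(i in _) _; set u := \sum_(e | _) _; set p := 2 ^+ m => h.
rewrite (_ : 2 * p / 4 * _ = a k ^+ 2 / 2 * p + 2 * (p / 4 * s)); last by field.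
by lra.
Qed.

(** Linear form in the indicators of e being included in A, suited to integration over a random
    A. *)
Lemma sum_sqr_dist_subset_count (R : realFieldType) (I : finType) (a : I -> R)
    (A : {set I}) (t : R) :
  \sum_i a i ^+ 2 / 2 *
    \sum_(e : {set I} | i \in e) (if e \subset A then 1 else 0) <=
  \sum_(e : {set I}) (if e \subset A then (t - \sum_(i in e) a i) ^+ 2 else 0).
Proof.
rewrite -big_mkcond/=; apply: le_trans (sum_sqr_dist_subset a A t).
rewrite mulr_sumr (bigID (mem A))/= [X in _ + X]big1 ?addr0; last first.
  move=> i iA; rewrite big1 ?mulr0// => e ie; case: ifPn => // eA.
  by move: iA; rewrite (fintype.subsetP eA).
apply: ler_sum => i iA.
(* Exactly half of the subsets of A contain a given i in A. *)
rewrite [X in _ * X](_ : _ = 2 ^+ #|A| / 2); last first.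
  rewrite -big_mkcondr/=.
  rewrite (eq_bigl (fun e : {set I} => (e \subset A) && (i \in e))); last first.
    by move=> e; rewrite andbC.
  rewrite big_mkcondr/= (big_subset_split _ iA).
  rewrite (eq_bigr (fun=> 1)); last first.
    move=> e; rewrite finset.subsetD1 => /andP[_ ie].
    by rewrite (negbTE ie) add0r finset.setU11.
  rewrite sumr_const -cardsE (_ : finset _ = powerset (A :\ i)); last first.
    by apply/setP => e; rewrite !inE.
  by rewrite card_powerset (cardsD1 i A) iA exprS natrX; field.
by rewrite le_eqVlt; apply/orP; left; apply/eqP; field.
Qed.

(** The default value 0 of the maximum adds nothing, as subgraphs start at height 0. *)
Lemma subgraph_bigmax (R : realType) (I : finType) (b : I -> R -> R) (e : {set I}) :
  subgraph (fun x => \big[Num.max/0]_(i in e) b i x) =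
  \big[setU/set0]_(i in e) subgraph (b i).
Proof.
rewrite -bigcup_seq_cond; apply/seteqP; split=> z.
  case=> z01 /andP[z0 /bigmax_gtP[|[i ie zi]]]; first by rewrite ltNge z0.
  by exists i; [rewrite /= mem_index_enum|split=> //; rewrite z0].
case=> i /= /andP[_ ie] [z01 /andP[z0 zi]]; split=> //; rewrite z0.
by apply: lt_le_trans zi _; exact: le_bigmax_cond.
Qed.

Section boundary_mean_subadditive.
Local Open Scope ereal_scope.
Context (R : realType) (n : nat).
Notation L := (boundary_mean_measure n (cst 0%R) : set (plane R) -> \bar R).

Lemma boundary_mean_measureU_le (A D : set (plane R)) :
  measurable A -> measurable D -> L (A `|` D) <= L A + L D.
Proof.
move=> mA mD; rewrite boundary_mean_measureU// addeC leeD2r//.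
by apply: le_boundary_mean_measure => //; exact: measurableD.
Qed.

Lemma boundary_mean_measure_bigsetU (I : finType) (e : {set I})
    (F : I -> set (plane R)) (C : R) :
  (forall i, measurable (F i)) -> (forall i, L (F i) <= C%:E) ->
  L (\big[setU/set0]_(i in e) F i) < +oo.
Proof.
move=> mF LF.
apply: (@le_lt_trans _ _ (\sum_(i in e) C%:E)); last by rewrite sumEFin ltry.
suff [] : measurable (\big[setU/set0]_(i in e) F i) /\
    L (\big[setU/set0]_(i in e) F i) <= \sum_(i in e) C%:E by [].
elim/big_ind2 : _ => //.
- by rewrite /boundary_mean_measure setI0 integral_set0; split.
- move=> A x D y [mA LA] [mD LD]; split; first exact: measurableU.
  by apply: le_trans (boundary_mean_measureU_le mA mD) _; exact: leeD.
Qed.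

End boundary_mean_subadditive.

Section hypercube.
Context (R : realType) (I : finType) (n : nat).
Variables (b : I -> R -> R) (P : (R -> R) -> probability (observation R) R).
Hypotheses (mb : forall i, measurable_fun setT (b i)).
Let g (e : {set I}) (x : R) : R := \big[Num.max/0]_(i in e) b i x.
Hypothesis P_ppp : forall e,
  is_poisson_process (boundary_mean_measure n (g e)) (P (g e)).
Variable C : R.
Hypothesis LC : forall i,
  (boundary_mean_measure n (cst 0%R) (subgraph (b i)) <= C%:E)%E.

Let L (A : set (plane R)) := boundary_mean_measure n (cst 0%R) A.
Let D e := subgraph (g e).
Let P0 := P (g finset.set0).
Let weight e := expR (- fine (L (D e))).

(** The index i is there because [LC] says nothing about C when I is empty. *)
Let C_ge0 (i : I) : 0 <= C.
Proof.
by rewrite -lee_fin; apply: le_trans (LC i); exact: boundary_mean_measure_ge0.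
Qed.

Let mD e : measurable (D e).
Proof.
rewrite /D subgraph_bigmax; apply: bigsetU_measurable => i _.
exact: (measurable_subgraph (@mb _)).
Qed.

Let LD_fin e : (L (D e) < +oo)%E.
Proof.
rewrite /D subgraph_bigmax; apply: boundary_mean_measure_bigsetU LC => i.
exact: (measurable_subgraph (@mb _)).
Qed.

Let g0 : g finset.set0 = cst 0.
Proof. by apply/funext => x; rewrite /g big_set0. Qed.

Let P0_void e : P0 (void (D e)) = (weight e)%:E.
Proof.
have P00 : is_poisson_process L P0 by have := P_ppp finset.set0; rewrite {1}g0.
rewrite (poisson_void P00)//; last exact: boundary_mean_measure_ge0.
rewrite -(fineK (_ : L (D e) \is a fin_num))//.
by rewrite ge0_fin_numE// boundary_mean_measure_ge0.
Qed.

(** Conditioning turns every weighted risk into an integral against the single measure [P0], so that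
    the risks of all alternatives can be summed under one integral. *)
Let weight_risk (e : {set I}) (f : observation R -> \bar R) :
  measurable_fun setT f -> (forall S, 0 <= f S)%E ->
  ((weight e)%:E * \int[P (g e)]_S f S = \int[P0]_(S in void (D e)) f S)%E.
Proof.
move=> mf f0.
have P00 : is_poisson_process L P0 by have := P_ppp finset.set0; rewrite {1}g0.
rewrite (poisson_conditioning_integral P00 (P_ppp e) (D := D e))//.
- by rewrite -(poisson_void P00)// ?P0_void//; exact: boundary_mean_measure_ge0.
- by move=> A _; exact: boundary_mean_measure_ge0.
- by move=> A mA; exact: boundary_mean_measureU.
- move=> A mA; apply: boundary_mean_measureD => x _.
  by rewrite /g; exact: bigmax_ge_id.
Qed.

Let void_subset e S : void (D e) S <->
  e \subset [set i | `[< void (subgraph (b i)) S >]]%SET.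
Proof.
rewrite /D subgraph_bigmax -bigcup_seq_cond; split.
  move=> vS; apply/fintype.subsetP => i ie; rewrite finset.inE; apply/asboolP.
  apply/seteqP; split=> // z [Sz zi]; rewrite -vS; split=> //; exists i => //.
  by rewrite /= mem_index_enum.
move=> /fintype.subsetP vS; apply/seteqP; split=> // z [Sz [i /= /andP[_ ie] zi]].
have := vS _ ie; rewrite finset.inE => /asboolP vi.
by have : set0 z by rewrite -vi.
Qed.

(** By subadditivity of L, adding the hat i to e multiplies the weight by at least exp(-C). Hence
    the sets containing i carry at least a share exp(-C)/2 of the total weight. *)
Let weight_half i :
  expR (- C) * \sum_e weight e <= 2 * \sum_(e : {set I} | i \in e) weight e.
Proof.
rewrite (bigID (fun e : {set I} => i \in e))/= mulrDr mulr2n mulrDl !mul1r lerD//.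
  rewrite ler_piMl ?sumr_ge0// => [e _|]; first exact: expR_ge0.
  by rewrite -expR0 ler_expR oppr_le0 (C_ge0 i).
rewrite [leRHS](reindex_onto (fun e : {set I} => i |: e) (fun e => e :\ i))/=;
  last first.
  by move=> e; exact: finset.setD1K.
rewrite [leRHS](eq_bigl (fun e : {set I} => i \notin e)); last first.
  move=> e; rewrite finset.setU11/=; have [ie|ie] := boolP (i \in e).
    by apply/negbTE; apply: contraL ie => /eqP <-; rewrite !inE eqxx.
  by rewrite finset.setU1K// eqxx.
rewrite mulr_sumr; apply: ler_sum => e ie; rewrite /weight -expRD ler_expR.
rewrite -opprD lerN2 -lee_fin EFinD.
rewrite !fineK ?ge0_fin_numE ?boundary_mean_measure_ge0//.
rewrite /D !subgraph_bigmax big_setU1//=.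
apply: le_trans (boundary_mean_measureU_le _ _ _) _.
- exact: (measurable_subgraph (@mb _)).
- by apply: bigsetU_measurable => j _; exact: (measurable_subgraph (@mb _)).
- exact: leeD2r.
Qed.

(** Bayes risk bound: the weighted sum of the risks is an integral under [P0], bounded below
    pointwise by [sum_sqr_dist_subset_count]; integrating the indicators back gives weights, to
    which [weight_half] applies. *)
Lemma hypercube_lower_bound (theta_hat : observation R -> R) (a : I -> R) (r : R) :
  measurable_fun setT theta_hat ->
  (forall e, squared_risk (P (g e)) theta_hat (\sum_(i in e) a i) <= r%:E)%E ->
  expR (- C) / 4 * \sum_i a i ^+ 2 <= r.
Proof.
move=> mtheta risk_le.
pose f (e : {set I}) S : R := (theta_hat S - \sum_(i in e) a i) ^+ 2.
have mf e : measurable_fun setT (f e).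
  by apply: measurable_funX; apply: measurable_funB.
pose v (e : {set I}) S : R :=
  if e \subset [set i | `[< void (subgraph (b i)) S >]]%SET then 1 else 0.
have vE e S : v e S = \1_(void (D e)) S.
  rewrite /v indicE; case: ifPn => [/void_subset vS|vS]; first by rewrite mem_set.
  by rewrite memNset// => /void_subset; exact/negP.
have mvoid e : measurable (void (D e)) by exact: measurable_void.
have mv e : measurable_fun setT (v e).
  rewrite (_ : v e = \1_(void (D e))); last by apply/funext => S; rewrite vE.
  exact: measurable_indic.
have int_v e : (\int[P0]_S (v e S)%:E = (weight e)%:E)%E.
  under eq_integral do rewrite vE.
  by rewrite integral_indic// setIT; exact: P0_void.
have int_f e : (\int[P0]_S (v e S * f e S)%:E <= (weight e * r)%:E)%E.
  apply: (@le_trans _ _ ((weight e)%:E * \int[P (g e)]_S (f e S)%:E)%E).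
    rewrite weight_risk//; last 2 first.
    - exact/measurable_EFinP.
    - by move=> S; rewrite lee_fin sqr_ge0.
    rewrite [leRHS]integral_mkcond le_eqVlt; apply/orP; left; apply/eqP.
    apply: eq_integral => S _; rewrite patchE vE indicE.
    by case: ifPn => _; rewrite ?mul1r ?mul0r.
  rewrite EFinM lee_pmul2l// ?lte_fin ?expR_gt0//.
  by have := risk_le e; rewrite /squared_risk unlock.
have mvs i : measurable_fun setT (fun S => \sum_(e : {set I} | i \in e) v e S).
  under eq_fun do rewrite big_mkcond.
  by apply: measurable_sum => e; case: (i \in e).
pose Z := \sum_e weight e.
have Z0 : 0 < Z.
  rewrite /Z (bigD1 finset.set0)//= ltr_pwDl ?expR_gt0 ?sumr_ge0// => e _.
  exact: expR_ge0.
(* The weights are not normalized; both sides are multiplied by their total instead. The 1/4 is the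
   1/2 kept with a_i^2 times the 1/2 of [weight_half]. *)
rewrite -(ler_pM2l Z0).
apply: (@le_trans _ _ (\sum_i a i ^+ 2 / 2 * \sum_(e : {set I} | i \in e) weight e)).
  rewrite !mulr_sumr; apply: ler_sum => i _; have := weight_half i; rewrite -/Z => h.
  have := ler_wpM2l (sqr_ge0 (a i)) h; set s := \sum_(e | _) _; lra.
rewrite [leRHS]mulr_suml -lee_fin -!sumEFin.
apply: (@le_trans _ _ (\int[P0]_S
  (\sum_i a i ^+ 2 / 2 * \sum_(e : {set I} | i \in e) v e S)%:E)%E).
  under eq_integral do rewrite -sumEFin.
  rewrite ge0_integral_sum//; last 2 first.
  - by move=> i; apply/measurable_EFinP; apply: measurable_funM.
  - move=> i S _; rewrite lee_fin mulr_ge0 ?divr_ge0 ?sqr_ge0// sumr_ge0// => e _.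
    by rewrite /v; case: ifP.
  apply: lee_sum => i _; under eq_integral do rewrite EFinM.
  rewrite ge0_integralZl//; last 3 first.
  - by apply/measurable_EFinP; exact: mvs.
  - by move=> S _; rewrite lee_fin sumr_ge0// => e _; rewrite /v; case: ifP.
  - by rewrite lee_fin divr_ge0 ?sqr_ge0.
  rewrite EFinM; under eq_integral do rewrite big_mkcond -sumEFin.
  rewrite lee_wpmul2l ?lee_fin ?divr_ge0 ?sqr_ge0//.
  rewrite ge0_integral_sum//; last 2 first.
  - by move=> e; apply/measurable_EFinP; case: (i \in e).
  - by move=> e S _; rewrite lee_fin /v; case: (i \in e) => //; case: ifP.
  rewrite [in leLHS]big_mkcond -sumEFin; apply: lee_sum => e _.
  by case: (i \in e); rewrite ?int_v// integral0.
(* Pointwise in S, with A the set of hats free of observed points and t the estimate. *)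
apply: (@le_trans _ _ (\int[P0]_S (\sum_e v e S * f e S)%:E)%E).
  apply: ge0_le_integral => //.
  - move=> S _; rewrite lee_fin sumr_ge0// => i _.
    rewrite mulr_ge0 ?divr_ge0 ?sqr_ge0// sumr_ge0// => e _.
    by rewrite /v; case: ifP.
  - apply/measurable_EFinP; apply: measurable_sum => i.
    by apply: measurable_funM.
  - apply/measurable_EFinP; apply: measurable_sum => e.
    by apply: measurable_funM; [exact: mv|exact: mf].
  - move=> S _; rewrite lee_fin.
    apply: le_trans (sum_sqr_dist_subset_count a _ (theta_hat S)) _.
    apply: ler_sum => e _; rewrite /v.
    by case: ifP; rewrite ?mul1r ?mul0r.
under eq_integral do rewrite -sumEFin.
rewrite ge0_integral_sum//; last 2 first.
- move=> e; apply/measurable_EFinP.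
  by apply: measurable_funM; [exact: mv|exact: mf].
- by move=> e S _; rewrite lee_fin mulr_ge0 ?sqr_ge0// /v; case: ifP.
by apply: lee_sum => e _; exact: int_f.
Qed.

End hypercube.

(** * Hat functions *)

Section hat.
Context {R : realType}.
Implicit Types (s t x y h : R).

(** A hat is a difference of two shifted clamps, which makes sums of consecutive hats telescope to a
    trapezoid. *)
Definition clamp t : R := Num.min 1 (Num.max 0 t).

Definition hat t : R := Num.max 0 (1 - `|t|).

Lemma hat_ge0 t : 0 <= hat t.
Proof. by rewrite /hat le_max lexx. Qed.

Lemma hat_le1 t : hat t <= 1.
Proof. by rewrite /hat ge_max ler01 lerBlDr lerDl normr_ge0. Qed.

Lemma hat_abs_le1 t : `|hat t| <= 1.
Proof. by rewrite ger0_norm ?hat_ge0// hat_le1. Qed.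

Lemma measurable_hat h (k : nat) :
  measurable_fun setT ((fun x => hat (x / h - k%:R)) : measurableTypeR R -> R).
Proof.
have mhat : measurable_fun setT (hat : R -> R).
  by apply: measurable_maxr => //; apply: measurable_funB.
apply: measurableT_comp => //.
by apply: measurable_funB => //; exact: measurable_funM.
Qed.

Lemma hat_eq0 t : 1 <= `|t| -> hat t = 0.
Proof. by move=> t1; rewrite /hat; apply/max_idPl; rewrite subr_le0. Qed.

Lemma hat_lipschitz s t : `|hat s - hat t| <= `|s - t|.
Proof.
have : `|(1 - `|s|) - (1 - `|t|)| <= `|s - t|.
  rewrite (_ : 1 - `|s| - _ = `|t| - `|s|); last by ring.
  by rewrite [leRHS]distrC; exact: ler_dist_dist.
rewrite /hat; move: (1 - `|s|) (1 - `|t|) `|s - t| => a b c.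
by rewrite !ler_norml => /andP[? ?]; case: (leP 0 a); case: (leP 0 b) => ? ?; lra.
Qed.

Lemma hat_clamp t : hat t = clamp (t + 1) - clamp t.
Proof.
rewrite /hat /clamp; case: (ger0P t) => t0.
  by repeat case: leP => ?; lra.
by repeat case: leP => ?; lra.
Qed.

Lemma clamp_ge0 t : 0 <= clamp t.
Proof. by rewrite /clamp le_min ler01 le_max lexx. Qed.

Lemma clamp_le1 t : clamp t <= 1.
Proof. by rewrite /clamp ge_min lexx. Qed.

Lemma clamp_le0 t : t <= 0 -> clamp t = 0.
Proof. by move=> t0; rewrite /clamp max_l// min_r. Qed.

Lemma clamp_ge1 t : 1 <= t -> clamp t = 1.
Proof. by move=> t1; rewrite /clamp max_r ?min_l// (le_trans ler01). Qed.

Lemma sum_hat (m : nat) t :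
  \sum_(i < m) hat (t - i.+1%:R) = clamp t - clamp (t - m%:R).
Proof.
elim: m => [|m IH]; first by rewrite big_ord0 subr0 subrr.
rewrite big_ord_recr/= IH hat_clamp (_ : t - m.+1%:R + 1 = t - m%:R); first by ring.
by rewrite -natr1; ring.
Qed.

Lemma sum_hat_parity (m : nat) (F : nat -> R) :
  \sum_(i < 2 * m) F i = \sum_(j < m) F (2 * j)%N + \sum_(j < m) F (2 * j + 1)%N.
Proof.
elim: m => [|m IH]; first by rewrite !big_ord0 addr0.
rewrite mulnS !add2n !big_ord_recr/= IH mulnC addn1; ring.
Qed.

(* The prefactor makes every bump beta-Hoelder with constant rad. *)
Definition bump (beta rad h : R) (k : nat) x : R :=
  rad * h `^ beta * hat (x / h - k%:R).

Variables (beta rad h : R).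
Hypotheses (beta_gt0 : 0 < beta) (beta_le1 : beta <= 1).
Hypotheses (rad_gt0 : 0 < rad) (h_gt0 : 0 < h).

Lemma bump_ge0 k x : 0 <= bump beta rad h k x.
Proof. by rewrite /bump mulr_ge0 ?hat_ge0// mulr_ge0 ?powR_ge0// ltW. Qed.

Lemma bump_le k x : bump beta rad h k x <= rad * h `^ beta.
Proof. by rewrite /bump ler_piMr ?hat_le1// mulr_ge0 ?powR_ge0// ltW. Qed.

(** Bumps have half-width h and centres kh, so those with indices two apart at most touch. *)
Lemma bump_disjoint k l x : (k.+2 <= l)%N ->
  bump beta rad h k x = 0 \/ bump beta rad h l x = 0.
Proof.
move=> kl; have : (k.+2%:R : R) <= l%:R by rewrite ler_nat.
rewrite -!natr1 => {}kl; set t := x / h.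
have [tk|tk] := leP (k%:R + 1) t.
  by left; rewrite /bump hat_eq0 ?mulr0// (le_trans _ (ler_norm _))//; rewrite -/t; lra.
right; rewrite /bump hat_eq0 ?mulr0// distrC (le_trans _ (ler_norm _))//.
by rewrite -/t; lra.
Qed.

(** Up to distance 1 the Lipschitz bound suffices, because d <= d^beta for beta <= 1; beyond it, the
    values lie in [0, 1]. *)
Lemma hat_holder s t : `|hat s - hat t| <= `|s - t| `^ beta.
Proof.
have [d1|d1] := leP `|s - t| 1; last first.
  apply: (@le_trans _ _ 1); last first.
    have := @ge0_ler_powR _ _ (ltW beta_gt0) 1 `|s - t|.
    by rewrite powR1; apply; rewrite ?nnegrE ?ler01 ?normr_ge0 ?(ltW d1).
  have := hat_ge0 s; have := hat_ge0 t; have := hat_le1 s; have := hat_le1 t.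
  by move=> ? ? ? ?; rewrite ler_norml; apply/andP; split; lra.
apply: le_trans (hat_lipschitz s t) _.
have [->|d0] := eqVneq `|s - t| 0; first by rewrite powR_ge0.
by apply: ger1_powR => //; rewrite lt_neqAle eq_sym d0 normr_ge0.
Qed.

Lemma bump_holder k x y :
  `|bump beta rad h k y - bump beta rad h k x| <= rad * `|y - x| `^ beta.
Proof.
have -> : `|y - x| `^ beta = h `^ beta * `|(y / h - k%:R) - (x / h - k%:R)| `^ beta.
  rewrite -(powRM _ (ltW h_gt0) (normr_ge0 _)); congr (_ `^ _).
  rewrite -[X in X * _](gtr0_norm h_gt0) -normrM; congr `|_|.
  by field; rewrite gt_eqF.
have c0 : 0 <= rad * h `^ beta by rewrite mulr_ge0 ?powR_ge0// ltW.
rewrite /bump -mulrBr normrM ger0_norm// [leRHS]mulrA.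
by apply: ler_wpM2l => //; exact: hat_holder.
Qed.

Lemma subgraph_bump k z : subgraph (bump beta rad h k) z ->
  (k%:R * h - h <= z.1 <= k%:R * h - h + 2 * h) && (0 <= z.2 <= rad * h `^ beta).
Proof.
case=> _ /andP[z0 zb]; rewrite z0 (le_trans (ltW zb) (bump_le _ _)) !andbT.
have : `|z.1 / h - k%:R| < 1.
  rewrite ltNge; apply/negP => /hat_eq0 hz.
  by move: zb; rewrite /bump hz mulr0 ltNge z0.
rewrite ltr_norml ltrBrDl ltr_pdivlMr// ltrBlDl ltr_pdivrMr//.
by rewrite !mulrDl mul1r mulN1r => /andP[? ?]; lra.
Qed.

Lemma measurable_bump k : measurable_fun setT (bump beta rad h k).
Proof.
by apply: measurable_funM => //; exact: measurable_hat.
Qed.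

End hat.

(** The maximum is 1-Lipschitz in the sup norm, so the alternatives inherit the Hoelder constant of
    a single bump. *)
Lemma bigmax_dist (R : realDomainType) (I : finType) (e : {set I})
    (F G : I -> R) (C : R) :
  0 <= C -> (forall i, `|F i - G i| <= C) ->
  `|\big[Num.max/0]_(i in e) F i - \big[Num.max/0]_(i in e) G i| <= C.
Proof.
move=> C0 FG; elim/big_ind2 : _ => [|a b c d|i _]; rewrite ?subrr ?normr0//.
rewrite !ler_norml => /andP[? ?] /andP[? ?].
by case: (leP a c); case: (leP b d) => ? ?; apply/andP; split; lra.
Qed.

(** At most one term is nonzero. The maximum form gives the Hoelder bound, the sum form makes the
    functional additive in e. *)
Lemma bigmax_sum (R : realDomainType) (I : finType) (e : {set I}) (F : I -> R) :
  (forall i, 0 <= F i) -> (forall i j, i != j -> F i = 0 \/ F j = 0) ->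
  \big[Num.max/0]_(i in e) F i = \sum_(i in e) F i.
Proof.
move=> F0 Fij.
have [[i [ie Fi]]|none] := pselect (exists i, i \in e /\ F i != 0); last first.
  have Fe i : i \in e -> F i = 0.
    by move=> ie; apply/eqP/negPn/negP => Fi; apply: none; exists i.
  rewrite [RHS]big1//.
  by elim/big_ind : _ => [//|x y -> ->|i /Fe//]; rewrite maxxx.
have Fj j : j != i -> F j = 0.
  by move=> /Fij[//|Fi0]; move: Fi; rewrite Fi0 eqxx.
rewrite [RHS](bigD1 i)//= big1 ?addr0 => [|j /andP[_ /Fj]//].
apply/eqP; rewrite eq_le (le_bigmax_cond _ F ie) andbT.
apply/bigmax_leP; split=> // j _.
by have [->//|/Fj ->] := eqVneq j i.
Qed.

(** * The weight function *)

Section weight.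
Context (R : realType) (w : R -> R).
Hypothesis w_L2 : on_unit_interval w \in Lfun lebesgue_measure 2%:E.
Local Notation mu := (@lebesgue_measure R).
Local Notation I01 := (`[0, 1]%classic : set (measurableTypeR R)).

Lemma integrable_on_unit_interval :
  mu.-integrable setT (EFin \o (on_unit_interval w : measurableTypeR R -> R)).
Proof.
have mw : measurable_fun setT (on_unit_interval w).
  by have /set_mem := sub_Lfun_mfun w_L2.
have sqr_int := Lfun2_integrable_sqr w_L2.
have cst_int : mu.-integrable setT (EFin \o (\1_I01 : measurableTypeR R -> R)).
  apply/integrableP; split.
    by apply/measurable_EFinP; exact: measurable_indic.
  under eq_integral do rewrite /= ger0_norm//.
  rewrite integral_indic//.
  rewrite setIT; suff : (mu I01 < +oo)%E by [].
  by rewrite lebesgue_measure_itv/= lte_fin ltr01 -EFinD ltry.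
apply: le_integrable (integrableD _ cst_int sqr_int) => //.
  exact/measurable_EFinP.
move=> x _ /=; rewrite lee_fin [leRHS]ger0_norm ?addr_ge0 ?sqr_ge0//.
rewrite /on_unit_interval patchE indicE; case: ifPn => x01; last first.
  by rewrite normr0 addr_ge0 ?sqr_ge0.
(* On the unit interval, 2 |w| <= 1 + w^2. *)
have := sqr_ge0 (`|w x| - 1); rewrite sqrrB1 real_normK ?num_real// => h.
by have := normr_ge0 (w x); rewrite mulr1n; lra.
Qed.

Lemma integrable_weight : mu.-integrable I01 (EFin \o (w : measurableTypeR R -> R)).
Proof.
have := integrable_on_unit_interval.
by rewrite /on_unit_interval -restrict_EFin -integrable_mkcond.
Qed.

Lemma integrable_weightM (b : measurableTypeR R -> R) (M : R) :
  measurable_fun setT b -> (forall x, `|b x| <= M) ->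
  mu.-integrable I01 (EFin \o (fun x => b x * w x)).
Proof.
move=> mb bM; have /integrableP[/measurable_EFinP mw _] := integrable_weight.
apply: le_integrable (integrableZl _ M integrable_weight) => //.
- by apply/measurable_EFinP; apply: measurable_funM => //; exact: measurable_funTS.
- move=> x _ /=; rewrite lee_fin !normrM ler_wpM2r//.
  by rewrite (le_trans (bM x))// ler_norm.
Qed.

Lemma weighted_integral_sum (I : Type) (s : seq I) (p : pred I)
    (b : I -> R -> R) (M : R) :
  (forall i, measurable_fun setT (b i : measurableTypeR R -> R)) ->
  (forall i x, `|b i x| <= M) ->
  weighted_integral w (fun x => \sum_(i <- s | p i) b i x) =
  \sum_(i <- s | p i) weighted_integral w (b i).
Proof.
move=> mb bM; rewrite /weighted_integral /Rintegral.
under eq_integral do rewrite mulr_suml -sumEFin.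
rewrite integral_sum//=; last first.
  by move=> i; apply: (integrable_weightM (mb i) (bM i)).
rewrite -sum_fine// => i _; apply: integrable_fin_num => //.
by apply: (integrable_weightM (mb i) (bM i)).
Qed.

Lemma weighted_integralZ (c : R) (b : R -> R) (M : R) :
  measurable_fun setT (b : measurableTypeR R -> R) -> (forall x, `|b x| <= M) ->
  weighted_integral w (fun x => c * b x) = c * weighted_integral w b.
Proof.
move=> mb bM; rewrite /weighted_integral.
under eq_Rintegral do rewrite -mulrA.
by rewrite RintegralZl//; exact: integrable_weightM mb bM.
Qed.

Lemma ae_neq (a : R) : {ae mu, forall x : R, x != a}.
Proof.
exists [set a]; split; first exact: measurable_set1.
  exact: lebesgue_measure_set1.
by move=> x /=; case: eqP => // ->.
Qed.

(* By Lebesgue differentiation, w would otherwise vanish almost everywhere. *)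
Lemma weight_integral_neq0 : 0 < L2norm w ->
  exists2 x0 : R, 0 < x0 <= 1 & \int[mu]_(x in `]0, x0[) w x != 0.
Proof.
move=> w_gt0; apply: contrapT => none.
have w0 y : 0 < y <= 1 -> \int[mu]_(x in `]0, y[) w x = 0.
  by move=> y01; apply/eqP/negPn/negP => h; apply: none; exists y.
pose f : measurableTypeR R -> R := on_unit_interval w.
have intf := integrable_on_unit_interval.
have locf : locally_integrable setT f.
  by apply: open_integrable_locally; [exact: openT|exact: intf].
have intfS y : mu.-integrable [set` Interval (BRight 0) (BRight y)] (EFin \o f).
  apply: integrableS intf => //; exact: measurable_itv.
pose F y := \int[mu]_(t in [set` Interval (BRight (0 : R)) (BRight y)]) f t.
have F0 y : 0 < y <= 1 -> F y = 0.
  move=> /[dup] y01 /andP[y0 y1]; rewrite -(w0 _ y01) /F.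
  rewrite Rintegral_itv_bndo_bndc//; last first.
    apply: integrableS integrable_weight => // x.
    by rewrite /= !in_itv/= => /andP[/ltW -> /ltW/le_trans ->].
  apply: eq_Rintegral => x /set_mem; rewrite /= in_itv/= => /andP[x0 xy].
  by rewrite /f /on_unit_interval patchE mem_set//= in_itv/= (ltW x0)/= (le_trans xy).
have f0 : {ae mu, forall x, f x = 0}.
  have FTC : {ae mu, forall x, (BRight (0 : R) < BRight x)%O ->
      derivable F x 1 /\ derive1 F x = f x}.
    exact: FTC1 intfS locf.
  have n0 : {ae mu, forall x : R, x != 0}.
    exact: ae_neq.
  (* The endpoints are discarded because F is known to vanish on a whole neighbourhood only for
     interior points. *)
  have n1 : {ae mu, forall x : R, x != 1}.
    exact: ae_neq.
  have AE := ae_filter_ringOfSetsType mu.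
  apply: filterS3 FTC n0 n1 => x FTCx x0 x1.
  have [x01|x01] := boolP (x \in `[0, 1]); last first.
    by rewrite /f /on_unit_interval patchE memNset// => /= h; rewrite h in x01.
  move: x01; rewrite in_itv/= !le_eqVlt eq_sym (negbTE x0) (negbTE x1)/=.
  move=> /andP[x_gt0 x_lt1].
  have [] := FTCx; first by rewrite bnd_simp.
  move=> _ <-; rewrite derive1E (@near_eq_derive _ _ _ _ (cst 0)) ?derive_cst//.
  near=> z; apply: F0; apply/andP; split; near: z.
    exact: lt_nbhsr.
  by apply: filterS (lt_nbhsl x_lt1) => z /ltW.
move: w_gt0; rewrite /L2norm.
suff -> : ('N[mu]_2%:E[EFin \o on_unit_interval w] = 0)%E by rewrite ltxx.
rewrite unlock /= (_ : (\int[mu]_x _ = 0)%E) ?poweR0r//.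
transitivity (\int[mu]_x (f x ^+ 2)%:E)%E.
  by apply: eq_integral => x _; rewrite /= powR_mulrn// real_normK ?num_real.
have mf := measurable_int _ intf.
rewrite (ae_eq_integral (cst 0%E)) ?integral0//.
  by apply/measurable_EFinP; apply: measurable_funX; exact/measurable_EFinP.
by apply: filterS f0 => x fx0 _ /=; rewrite fx0 expr0n.
Unshelve. all: by end_near.
Qed.

End weight.

(** * Trapezoids approximating the indicator of an interval *)

Section trapezoid.
Context (R : realType) (w : R -> R) (x0 : R).
Hypothesis w_L2 : on_unit_interval w \in Lfun lebesgue_measure 2%:E.
Hypothesis x0_01 : 0 < x0 <= 1.
Local Notation mu := (@lebesgue_measure R).
Local Notation I01 := (`[0, 1]%classic : set (measurableTypeR R)).

(** The hats centred at h, ..., 2mh have half-width h, so their supports fill exactly [0, (2m+1) h]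
    = [0, x0]. *)
Definition mesh (m : nat) : R := x0 / (2 * m).+1%:R.

Lemma mesh_gt0 m : 0 < mesh m.
Proof. by case/andP: x0_01 => ? _; rewrite divr_gt0. Qed.

Lemma mesh_cvg0 (e : R) : 0 < e -> \forall m \near \oo, mesh m <= e.
Proof.
move=> e0; have /andP[x_gt0 _] := x0_01.
near=> m; rewrite /mesh ler_pdivrMr// mulrC -ler_pdivrMr//.
apply: (@le_trans _ _ m%:R); last by rewrite ler_nat; lia.
by near: m; exact: nbhs_infty_ger.
Unshelve. all: by end_near. Qed.

Lemma sum_hat_mesh m (x : R) :
  0 <= \sum_(k < 2 * m) hat (x / mesh m - k.+1%:R) <= 1.
Proof.
apply/andP; split; first by apply: sumr_ge0 => k _; exact: hat_ge0.
by rewrite sum_hat; have := clamp_ge0 (x / mesh m - (2 * m)%:R);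
  have := clamp_le1 (x / mesh m); lra.
Qed.

(** The flat part [h, x0 - h] reaches any given x in ]0, x0[ once the mesh is small, and the
    trapezoid vanishes at 0 and beyond x0; hence eventual equality. *)
Lemma sum_hat_mesh_cvg (x : R) : 0 <= x ->
  \forall m \near \oo,
    \sum_(k < 2 * m) hat (x / mesh m - k.+1%:R) = \1_(`]0, x0[) x.
Proof.
move=> x_ge0; have /andP[x0_gt0 _] := x0_01; rewrite indicE.
have [x_x0|x_x0] := ltP x x0; last first.
  rewrite memNset/=; last by rewrite in_itv/= [x < _]ltNge x_x0 andbF.
  near=> m; have m0 := mesh_gt0 m; rewrite sum_hat !clamp_ge1 ?subrr//.
    by rewrite lerBrDr nat1r ler_pdivlMr// /mesh mulrC divfK.
  rewrite ler_pdivlMr// mul1r; apply: le_trans x_x0.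
  by rewrite /mesh ler_pdivrMr// ler_peMr ?ler1n// ltW.
have [x_gt0|x_le0] := ltP 0 x; last first.
  have -> : x = 0 by apply/eqP; rewrite eq_le x_ge0 x_le0.
  rewrite memNset/=; last by rewrite in_itv/= ltxx.
  near=> m; rewrite sum_hat !clamp_le0 ?subrr// mul0r// sub0r oppr_le0//.
rewrite mem_set/=; last by rewrite in_itv/= x_gt0.
near=> m; have m0 := mesh_gt0 m; rewrite sum_hat clamp_ge1 ?clamp_le0 ?subr0//.
  rewrite subr_le0 ler_pdivrMr//.
  have hm : mesh m <= x0 - x by near: m; apply: mesh_cvg0; rewrite subr_gt0.
  have : (2 * m)%:R * mesh m + mesh m = x0.
    by rewrite -[X in _ + X]mul1r -mulrDl natr1 /mesh mulrC divfK.
  by lra.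
rewrite ler_pdivlMr// mul1r.
by near: m; exact: mesh_cvg0.
Unshelve. all: by end_near. Qed.

Lemma weighted_integral_sum_hat_cvg :
  weighted_integral w (fun x => \sum_(k < 2 * m) hat (x / mesh m - k.+1%:R))
    @[m --> \oo] --> \int[mu]_(x in `]0, x0[) w x.
Proof.
have /andP[x0_gt0 x0_le1] := x0_01.
pose T m (x : R) := \sum_(k < 2 * m) hat (x / mesh m - k.+1%:R).
have mT m : measurable_fun setT (T m).
  by apply: measurable_sum => k; exact: measurable_hat.
have iw := integrable_weight w_L2.
have /integrableP[/measurable_EFinP mw _] := iw.
have [] := @dominated_convergence _ _ _ mu I01 (measurable_itv _)
  (fun m x => (T m x * w x)%:E) (fun x => (\1_(`]0, x0[%classic) x * w x)%:E)
  (fun x => `|w x|%:E).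
- move=> m; apply/measurable_EFinP; apply: measurable_funM => //.
  by apply: measurable_funTS; exact: mT.
- by apply/measurable_EFinP; apply: measurable_funM.
- apply: aeW => x /=; rewrite in_itv/= => /andP[x_ge0 _].
  apply: cvg_near_cst; near=> m; congr (_ * _)%:E.
  by near: m; exact: sum_hat_mesh_cvg.
- exact: integrable_abse iw.
- apply: aeW => x m _ /=; rewrite lee_fin normrM ler_piMl//.
  by have /andP[? ?] := sum_hat_mesh m x; rewrite ger0_norm.
move=> ilim _ cvgT.
have -> : \int[mu]_(x in `]0, x0[) w x =
    fine (\int[mu]_(x in I01) (\1_(`]0, x0[%classic) x * w x)%:E)%E.
  rewrite /Rintegral integral_mkcond [in RHS]integral_mkcond; congr fine.
  apply: eq_integral => x _; rewrite !patchE indicE.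
  have [x0x|x0x] := boolP (x \in _).
    rewrite mem_set ?mul1r//; move/set_mem: x0x; rewrite /= !in_itv/=.
    by move=> /andP[/ltW -> /ltW/le_trans ->].
  by case: ifP; rewrite ?mul0r.
apply: fine_cvg; rewrite fineK//; exact: integrable_fin_num ilim.
Unshelve. all: by end_near. Qed.

End trapezoid.

(** * Rates *)

(** Cauchy-Schwarz, from expanding the sum of the squares (m B_i - S)^2 >= 0. *)
Lemma sqr_sum_le (R : realFieldType) (m : nat) (B : 'I_m -> R) :
  (\sum_i B i) ^+ 2 <= m%:R * \sum_i B i ^+ 2.
Proof.
case: m B => [|m] B; first by rewrite !big_ord0 mulr0 expr0n.
set S := \sum_i B i; set Q := \sum_i B i ^+ 2.
have : 0 <= \sum_i (m.+1%:R * B i - S) ^+ 2 by apply: sumr_ge0 => i _; exact: sqr_ge0.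
have -> : \sum_i (m.+1%:R * B i - S) ^+ 2 = m.+1%:R * (m.+1%:R * Q - S ^+ 2).
  rewrite (eq_bigr (fun i => m.+1%:R ^+ 2 * B i ^+ 2 +
    (- (2 * m.+1%:R * S)) * B i + S ^+ 2)); last by move=> i _; ring.
  rewrite !big_split/= -!mulr_sumr -/Q -/S sumr_const card_ord -mulr_natl.
  ring.
by rewrite pmulr_rge0// subr_ge0.
Qed.

Section risk.
Context (R : realType) (beta rad x0 : R) (w : R -> R).
Variable P : nat -> (R -> R) -> probability (observation R) R.
Hypotheses (beta_gt0 : 0 < beta) (beta_le1 : beta <= 1) (rad_gt0 : 0 < rad).
Hypothesis w_L2 : on_unit_interval w \in Lfun lebesgue_measure 2%:E.
Hypothesis P_ppp : forall (n : nat) (g : R -> R), (0 < n)%N ->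
  holder_class beta rad g ->
  is_poisson_process (boundary_mean_measure n g) (P n g).
Hypothesis x0_01 : 0 < x0 <= 1.

Lemma risk_lower_bound (n m : nat) (delta rho : R)
    (theta_hat : observation R -> R) :
  (0 < n)%N -> (0 < m)%N -> 0 <= delta ->
  n%:R * (mesh x0 m * mesh x0 m `^ beta) <= 1 ->
  delta <= `|weighted_integral w (fun x =>
    \sum_(k < 2 * m) hat (x / mesh x0 m - k.+1%:R))| ->
  measurable_fun setT theta_hat ->
  (forall g, holder_class beta rad g ->
    (squared_risk (P n g) theta_hat (weighted_integral w g) <= rho%:E)%E) ->
  expR (- (2 * rad)) / 4 *
    (rad ^+ 2 * (mesh x0 m `^ beta) ^+ 2 * ((delta / 2) ^+ 2 / m%:R)) <= rho.
Proof.
move=> n0 m0 delta0; set h := mesh x0 m => nh deltaw mtheta risk_le.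
have h0 : 0 < h by exact: mesh_gt0.
pose B k := weighted_integral w (fun x => hat (x / h - k.+1%:R)).
(* One of the parities 0 and 1 carries half of the integral; which one is immaterial, as a common
   offset r keeps the indices two apart. *)
have [r rB] : exists r : nat, delta / 2 <= `|\sum_(j < m) B (2 * j + r)%N|.
  move: deltaw; rewrite (@weighted_integral_sum _ _ w_L2 _ _ _
    (fun (k : 'I_(2 * m)) x => hat (x / h - k.+1%:R)) 1) => [||k x]; last 2 first.
  - by move=> k; exact: measurable_hat.
  - exact: hat_abs_le1.
  rewrite (sum_hat_parity m B) => deltaw.
  apply: contrapT => none.
  have small r : `|\sum_(j < m) B (2 * j + r)%N| < delta / 2.
    by rewrite ltNge; apply/negP => h'; apply: none; exists r.
  have := ler_normD (\sum_(j < m) B (2 * j)%N) (\sum_(j < m) B (2 * j + 1)%N).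
  have e0 : \sum_(j < m) B (2 * j)%N = \sum_(j < m) B (2 * j + 0)%N.
    by apply: eq_bigr => j _; rewrite addn0.
  have := small 1%N; have := small 0%N; rewrite -e0.
  lra.
pose b (j : 'I_m) := bump beta rad h (2 * j + r).+1.
pose a (j : 'I_m) := rad * h `^ beta * B (2 * j + r)%N.
have c0 : 0 <= rad * h `^ beta by rewrite mulr_ge0 ?powR_ge0// ltW.
have bdisj x (i j : 'I_m) : i != j -> b i x = 0 \/ b j x = 0.
  move=> ne; have /orP[ij|ij] : (i < j)%N || (j < i)%N by rewrite -neq_ltn.
    by apply: bump_disjoint; clear -ij; lia.
  by apply/or_comm/bump_disjoint; clear -ij; lia.
have mb i : measurable_fun setT (b i) by exact: measurable_bump.
have b_ge0 i x : 0 <= b i x by exact: bump_ge0.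
have b_le i x : `|b i x| <= rad * h `^ beta.
  by rewrite ger0_norm ?b_ge0//; exact: bump_le.
pose g (e : {set 'I_m}) x := \big[Num.max/0]_(i in e) b i x.
have holder_g e : holder_class beta rad (g e).
  move=> x y _ _; apply: bigmax_dist => [|i].
    by rewrite mulr_ge0 ?powR_ge0// ltW.
  exact: bump_holder.
have theta_g e : weighted_integral w (g e) = \sum_(i in e) a i.
  have -> : g e = fun x => \sum_(i in e) b i x.
    by apply/funext => x; exact: (@bigmax_sum _ _ e (b^~ x) (b_ge0^~ x) (bdisj x)).
  rewrite (@weighted_integral_sum _ _ w_L2 _ _ _ _ (rad * h `^ beta))//.
  apply: eq_bigr => i _; rewrite /b /bump.
  apply: (@weighted_integralZ _ _ w_L2 _ _ 1); first exact: measurable_hat.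
  by move=> x; exact: hat_abs_le1.
(* The box has area 2h * rad h^beta, and n h^(beta+1) <= 1. *)
have LC i : (boundary_mean_measure n (cst 0%R) (subgraph (b i)) <= (2 * rad)%:E)%E.
  apply: (@le_trans _ _ (n%:R * (2 * h * (rad * h `^ beta)))%:E).
    apply: (@boundary_mean_measure_box _ _ _ ((2 * i + r).+1%:R * h - h)) => //.
    - exact: (measurable_subgraph (mb i)).
    - by rewrite mulr_ge0// ltW.
    - by move=> z; exact: subgraph_bump.
  rewrite lee_fin (_ : n%:R * _ = 2 * rad * (n%:R * (h * h `^ beta))); last by ring.
  by rewrite ler_piMr// mulr_ge0// ltW.
have risk_e e :
    (squared_risk (P n (g e)) theta_hat (\sum_(i in e) a i) <= rho%:E)%E.
  by rewrite -theta_g; exact: risk_le.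
apply: le_trans (@hypercube_lower_bound R 'I_m n b (P n) mb
  (fun e => P_ppp n0 (holder_g e)) (2 * rad) LC theta_hat a rho mtheta risk_e).
rewrite -/h; apply: ler_wpM2l; first by rewrite divr_ge0 ?expR_ge0.
rewrite (eq_bigr (fun i : 'I_m =>
  (rad * h `^ beta) ^+ 2 * B (2 * i + r)%N ^+ 2)); last first.
  by move=> i _; rewrite /a exprMn.
rewrite -mulr_sumr [(rad * _) ^+ 2]exprMn; apply: ler_wpM2l.
  by rewrite mulr_ge0 ?sqr_ge0.
rewrite ler_pdivrMr ?ltr0n// [leRHS]mulrC.
apply: le_trans (sqr_sum_le _); rewrite -[leRHS]real_normK ?num_real//.
by rewrite lerXn2r ?nnegrE ?divr_ge0.
Qed.

End risk.

(** With N = n^(1/(beta+1)), both m and 1/h are of order N: n h^(beta+1) = (N h)^(beta+1), and the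
    second right-hand side is (N h)^(2 beta) N / m. *)
Lemma mesh_rate (R : realType) (beta x0 : R) (n : nat) :
  0 < beta -> 0 < x0 <= 1 -> (0 < n)%N ->
  let m := (Num.truncn (n%:R `^ (beta + 1)^-1)).+1 in
  n%:R * (mesh x0 m * mesh x0 m `^ beta) <= 1 /\
  ((x0 / 6) `^ beta) ^+ 2 / 2 <=
  n%:R `^ ((2 * beta + 1) / (beta + 1)) * ((mesh x0 m `^ beta) ^+ 2 / m%:R).
Proof.
move=> beta_gt0 x0_01 n0; have /andP[x0_gt0 x0_le1] := x0_01.
set N := n%:R `^ (beta + 1)^-1 => m; set h := mesh x0 m.
have b1 : beta + 1 != 0 by rewrite gt_eqF// addr_gt0.
have n_ge1 : 1 <= n%:R :> R by rewrite ler1n.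
have N_ge1 : 1 <= N.
  by rewrite -(powRr0 n%:R) /N ler_powR// invr_ge0 addr_ge0// ltW.
have N_gt0 : 0 < N by exact: lt_le_trans N_ge1.
have h_gt0 : 0 < h by exact: mesh_gt0.
have NE : N `^ (beta + 1) = n%:R by rewrite -powRrM mulVf// powRr1.
have NE2 : n%:R `^ ((2 * beta + 1) / (beta + 1)) = (N `^ beta) ^+ 2 * N.
  rewrite mulrC powRrM -/N powRD ?(gt_eqF N_gt0) ?implybT//.
  rewrite powRr1 ?(ltW N_gt0)//.
  by rewrite [2 * beta]mulrC powRrM powR_mulrn ?powR_ge0.
have N_m : N <= m%:R by exact/ltW/truncnS_gt.
have m_N : m%:R <= N + 1 by rewrite /m -natr1 lerD2r truncn_le ltW.
have mh : (2 * m%:R + 1) * h = x0.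
  by rewrite /h /mesh -[(2 * m).+1%:R]natr1 natrM mulrC divfK// gt_eqF// ltr_wpDl.
(* From N <= m <= N + 1 and N >= 1, 2N <= 2m + 1 <= 5N while (2m + 1) h = x0 <= 1; the 6 is not
   sharp. *)
have [Nh Nh6] : N * h <= 1 /\ x0 / 6 <= N * h.
  have := ler_wpM2r (ltW h_gt0) N_m; have := ler_wpM2r (ltW h_gt0) m_N.
  have := ler_wpM2r (ltW h_gt0) N_ge1; have := mulr_gt0 N_gt0 h_gt0.
  by move: mh; lra.
have Nh0 : 0 <= N * h by rewrite mulr_ge0 ?ltW.
split.
  rewrite -NE powRD ?(gt_eqF N_gt0) ?implybT// powRr1 ?(ltW N_gt0)//.
  rewrite (_ : _ * _ = (N * h) * (N `^ beta * h `^ beta)); last by ring.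
  rewrite -(powRM _ (ltW N_gt0) (ltW h_gt0)).
  have := @ge0_ler_powR _ _ (ltW beta_gt0) (N * h) 1.
  rewrite powR1 => /(_ Nh0 ler01 Nh) hp.
  by apply: mulr_ile1 => //; exact: powR_ge0.
rewrite NE2 [leRHS](_ : _ = (N `^ beta * h `^ beta) ^+ 2 * (N / m%:R)); last first.
  by ring.
rewrite -(powRM _ (ltW N_gt0) (ltW h_gt0)); apply: ler_pM.
- exact: sqr_ge0.
- by rewrite invr_ge0.
- rewrite lerXn2r ?nnegrE ?powR_ge0//.
  by apply: ge0_ler_powR; rewrite ?nnegrE ?divr_ge0// ltW.
- by rewrite ler_pdivlMr ?ltr0n//; lra.
Qed.

Theorem theorem2p6 (R : realType) (beta rad : R) (w : R -> R)
    (P : nat -> (R -> R) -> probability (observation R) R)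
    (beta_gt0 : 0 < beta) (beta_le1 : beta <= 1) (rad_gt0 : 0 < rad)
    (w_L2 : on_unit_interval w \in Lfun lebesgue_measure 2%:E)
    (w_gt0 : 0 < L2norm w)
    (P_ppp : forall (n : nat) (g : R -> R), (0 < n)%N ->
       holder_class beta rad g ->
       is_poisson_process (boundary_mean_measure n g) (P n g)) :
  (0 < limn_einf (fun n : nat =>
    ereal_inf [set
      ereal_sup [set
        (rad `^ (- (beta + 1)^-1)
           * n%:R `^ ((2 * beta + 1) / (beta + 1))
           * L2norm w ^- 2)%:E
        * squared_risk (P n g) theta_hat (weighted_integral w g)
      | g in holder_class beta rad]
    | theta_hat in @estimator R]))%E.
Proof.
have [x0 x0_01 v_neq0] := weight_integral_neq0 w_L2 w_gt0.
have := weighted_integral_sum_hat_cvg w_L2 x0_01.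
(* From [m0] on, the trapezoid integral is within |v|/2 of v, hence at least |v|/2 in absolute
   value. *)
set v := (X in _ --> X) => /cvgrPdist_le/(_ (`|v| / 2)) [|m0 _ m0P].
  by rewrite divr_gt0// normr_gt0.
pose K : R := rad `^ (- (beta + 1)^-1) * L2norm w ^- 2.
have K_gt0 : 0 < K by rewrite mulr_gt0 ?powR_gt0// invr_gt0 exprn_gt0.
have x0_gt0 : 0 < x0 by case/andP: x0_01.
pose M : R := expR (- (2 * rad)) / 4 * (rad ^+ 2 * (`|v| / 2 / 2) ^+ 2).
have M_gt0 : 0 < M.
  rewrite /M mulr_gt0 ?divr_gt0 ?expR_gt0// mulr_gt0 ?exprn_gt0//.
  by rewrite !divr_gt0 ?normr_gt0.
pose c : R := K * M * (((x0 / 6) `^ beta) ^+ 2 / 2).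
have c_gt0 : 0 < c.
  by rewrite /c mulr_gt0 ?(mulr_gt0 K_gt0)// divr_gt0// exprn_gt0// powR_gt0// divr_gt0.
apply: (@lt_le_trans _ _ c%:E); first by rewrite lte_fin.
rewrite limn_einf_lim; apply: lime_ge; first exact: is_cvg_einfs.
(* For n >= n0 > m0^(beta+1), the number m of hats attached to n is at least m0. *)
pose n0 := (Num.truncn (m0%:R `^ (beta + 1) : R)).+1.
exists n0 => // n1 /= n0n1; apply: le_ereal_inf_tmp => _ [n /= n1n <-].
have n0n : (n0 <= n)%N by exact: leq_trans n1n.
have n_gt0 : (0 < n)%N by exact: leq_trans n0n.
apply: le_ereal_inf_tmp => _ [theta_hat mtheta <-].
have [] := mesh_rate beta_gt0 x0_01 n_gt0; set m := (_.+1) => rate1 rate2.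
have m0m : (m0 <= m)%N.
  apply: ltnW; rewrite -(ltr_nat R); apply: le_lt_trans (truncnS_gt _).
  have b1 : 0 < beta + 1 by rewrite addr_gt0.
  rewrite [leLHS](_ : _ = (m0%:R `^ (beta + 1)) `^ (beta + 1)^-1); last first.
    by rewrite -powRrM divff ?lt0r_neq0// powRr1.
  apply: ge0_ler_powR; rewrite ?nnegrE ?powR_ge0 ?invr_ge0 ?(ltW b1)//.
  by apply: le_trans (ltW (truncnS_gt _)) _; rewrite ler_nat.
set Kn := _ * _ * _ : R.
have Kn_gt0 : 0 < Kn.
  by rewrite !mulr_gt0 ?powR_gt0 ?ltr0n// invr_gt0 exprn_gt0.
set S := [set _ | _ in _].
have le_sup g : holder_class beta rad g ->
    (Kn%:E * squared_risk (P n g) theta_hat (weighted_integral w g) <= ereal_sup S)%E.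
  by move=> gh; apply: ereal_sup_ubound; exists g.
(* The zero function is in the class, which rules out a supremum equal to [-oo]; the value [+oo] is
   harmless. *)
have sup_ge0 : (0 <= ereal_sup S)%E.
  apply: le_trans (le_sup (cst 0) _); last first.
    by move=> x y _ _; rewrite subrr normr0 mulr_ge0 ?powR_ge0// ltW.
  apply: mule_ge0; first by rewrite lee_fin ltW.
  rewrite /squared_risk unlock.
  by apply: integral_ge0 => s _; rewrite lee_fin sqr_ge0.
case: (ereal_sup S) sup_ge0 le_sup => [r r_ge0 le_r|_ _|//]; last by rewrite leey.
rewrite lee_fin.
have delta_le : `|v| / 2 <= `|weighted_integral w (fun x =>
    \sum_(k < 2 * m) hat (x / mesh x0 m - k.+1%:R))|.
  have := m0P m m0m; set u := weighted_integral _ _ => /= vu.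
  have := ler_normD (v - u) u; rewrite subrK; lra.
(* A finite supremum r bounds all risks by r / Kn, the uniform bound that [risk_lower_bound]
   takes. *)
have risk_le g : holder_class beta rad g ->
    (squared_risk (P n g) theta_hat (weighted_integral w g) <= (r / Kn)%:E)%E.
  move=> gh; rewrite -(@lee_pmul2l _ Kn%:E)// -EFinM mulrCA divff ?lt0r_neq0//.
  by rewrite mulr1; exact: le_r.
have delta_ge0 : 0 <= `|v| / 2 by rewrite divr_ge0.
have := risk_lower_bound beta_gt0 beta_le1 rad_gt0 w_L2 P_ppp x0_01 n_gt0
  (isT : (0 < m)%N) delta_ge0 rate1 delta_le mtheta risk_le.
rewrite ler_pdivlMr//; apply: le_trans.
rewrite [leRHS](_ : _ = K * M * (n%:R `^ ((2 * beta + 1) / (beta + 1)) *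
  ((mesh x0 m `^ beta) ^+ 2 / m%:R))); last by rewrite /Kn /K /M; ring.
by apply: ler_wpM2l => //; rewrite mulr_ge0// ltW.
Qed.
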